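(* Let $(L,A,[\cdot,\cdot],\mu)$ be a Lie-Rinehart superalgebra and let $\tau:L\to\mathbb K$ be a supertrace. If $$\tau(ax)\,y=\tau(x)\,ay\qquad\text{for all } x,y\in\mathcal H(L),\ a\in\mathcal H(A),$$ then $(L,A,[\cdot,\cdot,\cdot]_\tau,\rho_\tau)$ is a $3$-Lie-Rinehart superalgebra, where for homogeneous elements $$[x_1,x_2,x_3]_\tau=\tau(x_1)[x_2,x_3]-(-1)^{\bar x_1\bar x_2}\tau(x_2)[x_1,x_3]+(-1)^{\bar x_3(\bar x_1+\bar x_2)}\tau(x_3)[x_1,x_2],$$ $$\rho_\tau(x,y)=\tau(x)\mu(y)-(-1)^{\bar x\bar y}\tau(y)\mu(x).$$
   Context: $\mathbb K$ is the base field; all vector spaces are $\mathbb Z_2$-graded, $\bar v$ is the degree of a homogeneous element $v$, and $\mathcal H(V)$ is the set of homogeneous elements of $V$. $A$ is an associative supercommutative superalgebra over $\mathbb K$; $Der(A)$ is the space of its superderivations. In all identities the elements are homogeneous. Lie superalgebra: $\mathbb Z_2$-graded space with an even bilinear bracket with $[x,y]=-(-1)^{\bar x\bar y}[y,x]$ and $(-1)^{\bar x\bar z}[x,[y,z]]+(-1)^{\bar y\bar x}[y,[z,x]]+(-1)^{\bar z\bar y}[z,[x,y]]=0$. A representation on $V$ is an even linear map $\mu:\mathfrak g\to\mathfrak{gl}(V)$ with $\mu([x,y])=\mu(x)\mu(y)-(-1)^{\bar x\bar y}\mu(y)\mu(x)$. A supertrace is an even linear form $\tau:\mathfrak g\to\mathbb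 K$ with $\tau([x,y])=0$ for all $x,y$. Lie-Rinehart superalgebra $(L,A,[\cdot,\cdot],\mu)$: $L$ is a Lie superalgebra over $\mathbb K$ and an $A$-module, $\mu:L\to Der(A)$ is an even linear map that is a representation of $L$ on $A$, $\mu(ax)=a\mu(x)$, and $[x,ay]=\mu(x)(a)\,y+(-1)^{\bar a\bar x}a[x,y]$. 3-Lie superalgebra: $\mathbb Z_2$-graded space $\mathfrak g$ with an even trilinear bracket such that $[x,y,z]=-(-1)^{\bar x\bar y}[y,x,z]$, $[x,y,z]=-(-1)^{\bar y\bar z}[x,z,y]$ and $[x,y,[z,u,v]]=[[x,y,z],u,v]+(-1)^{\bar z(\bar x+\bar y)}[z,[x,y,u],v]+(-1)^{(\bar z+\bar u)(\bar x+\bar y)}[z,u,[x,y,v]]$. Representation of a 3-Lie superalgebra $\mathfrak g$ on a graded space $V$: an even linear map $\rho:\mathfrak g\wedge\mathfrak g\to\mathfrak{gl}(V)$ with $\rho(x_1,x_2)\rho(x_3,x_4)-(-1)^{(\bar x_1+\bar x_2)(\bar x_3+\bar x_4)}\rho(x_3,x_4)\rho(x_1,x_2)=\rho([x_1,x_2,x_3],x_4)-(-1)^{\bar x_3\bar x_4}\rho([x_1,x_2,x_4],x_3)$ and $\rho([x_1,x_2,x_3],x_4)=\rho(x_1,x_2)\rho(x_3,x_4)+(-1)^{\bar x_1(\bar x_2+\bar x_3)}\rho(x_2,x_3)\rho(x_1,x_4)+(-1)^{\bar x_3(\bar x_1+\bar x_2)}\rho(x_3,x_1)\rho(x_2,x_4)$.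 3-Lie-Rinehart superalgebra $(L,A,[\cdot,\cdot,\cdot],\rho)$: $A$ is an associative supercommutative superalgebra, $L$ an $A$-module, $(L,[\cdot,\cdot,\cdot])$ a 3-Lie superalgebra, $\rho:L\times L\to Der(A)$ a representation of it on $A$, such that $\rho(ax,y)=(-1)^{\bar a\bar x}\rho(x,ay)=a\rho(x,y)$ and $[x,y,az]=(-1)^{\bar a(\bar x+\bar y)}a[x,y,z]+\rho(x,y)(a)\,z$. *)

(* Defs.v *)
From HB Require Import structures.
From mathcomp Require Import all_boot all_order all_algebra.

Set Implicit Arguments.
Unset Strict Implicit.
Unset Printing Implicit Defensive.

Import GRing.Theory.
Local Open Scope ring_scope.

(* Degrees in Z/2 are booleans (false = even, true = odd): i (+) j is the     *)
(* sum of two degrees and i && j their product, so that the Koszul sign       *)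
(* (-1)^{i j} is (-1) ^+ (i && j).                                            *)

(* A Z/2-grading V = V_0 (+) V_1 is given by the two projections              *)
(* hcomp i : V -> V_i of the direct sum.                                      *)
HB.mixin Record isSuperSpace (K : fieldType) V of GRing.Lmodule K V := {
  hcomp : bool -> V -> V;
  hcomp_linear : forall i, linear (hcomp i);
  hcomp_proj : forall i j v, hcomp i (hcomp j v) = if i == j then hcomp j v else 0;
  hcomp_sum : forall v, hcomp false v + hcomp true v = v
}.

#[short(type="superSpaceType")]
HB.structure Definition SuperSpace (K : fieldType) :=
  { V of isSuperSpace K V & GRing.Lmodule K V }.

(* hdeg i v : v belongs to V_i. Zero is homogeneous of both degrees, hence    *)
(* the identities below quantify over the degrees as well as the elements.    *)
Definition hdeg (K : fieldType) (V : superSpaceType K) (i : bool) (v : V) : Prop :=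
  hcomp i v = v.

Section Structures.
Variable K : fieldType.

Definition even_bilinear (U V W : superSpaceType K) (f : U -> V -> W) : Prop :=
  bilinear_for *:%R *:%R f /\
  forall i j u v, hdeg i u -> hdeg j v -> hdeg (i (+) j) (f u v).

Definition even_trilinear (T U V W : superSpaceType K)
    (f : T -> U -> V -> W) : Prop :=
  [/\ forall t u, linear (f t u),
      forall t v, linear (fun u => f t u v),
      forall u v, linear (fun t => f t u v) &
      forall i j k t u v, hdeg i t -> hdeg j u -> hdeg k v ->
        hdeg (i (+) j (+) k) (f t u v)].

(* No unit is required of A, and accordingly none acts on modules.            *)
Record supercomm_superalgebra (A : superSpaceType K) (mul : A -> A -> A) : Prop := {
  sa_even : even_bilinear mul;
  sa_assoc : forall a b c, mul a (mul b c) = mul (mul a b) c;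
  sa_comm : forall i j a b, hdeg i a -> hdeg j b ->
    mul a b = (-1) ^+ (i && j) *: mul b a
}.

Record supermodule (A M : superSpaceType K) (mul : A -> A -> A)
    (act : A -> M -> M) : Prop := {
  sm_even : even_bilinear act;
  sm_assoc : forall a b m, act (mul a b) m = act a (act b m)
}.

(* The elements of degree d of Der(A). *)
Record superderivation (A : superSpaceType K) (mul : A -> A -> A)
    (d : bool) (D : A -> A) : Prop := {
  sd_linear : linear D;
  sd_deg : forall i a, hdeg i a -> hdeg (d (+) i) (D a);
  sd_leibniz : forall i j a b, hdeg i a -> hdeg j b ->
    D (mul a b) = mul (D a) b + (-1) ^+ (d && i) *: mul a (D b)
}.

Record lie_superalgebra (L : superSpaceType K) (br : L -> L -> L) : Prop := {
  lie_even : even_bilinear br;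
  lie_skew : forall i j x y, hdeg i x -> hdeg j y ->
    br x y = - ((-1) ^+ (i && j) *: br y x);
  lie_jacobi : forall i j k x y z, hdeg i x -> hdeg j y -> hdeg k z ->
    (-1) ^+ (i && k) *: br x (br y z) + (-1) ^+ (j && i) *: br y (br z x)
      + (-1) ^+ (k && j) *: br z (br x y) = 0
}.

(* An even linear map L -> gl(V) is given as an even bilinear L -> V -> V. *)
Record lie_representation (L V : superSpaceType K) (br : L -> L -> L)
    (mu : L -> V -> V) : Prop := {
  lrep_even : even_bilinear mu;
  lrep_bracket : forall i j x y, hdeg i x -> hdeg j y -> forall v,
    mu (br x y) v = mu x (mu y v) - (-1) ^+ (i && j) *: mu y (mu x v)
}.

(* The ground field is concentrated in degree 0. *)
Record supertrace (L : superSpaceType K) (br : L -> L -> L)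
    (tau : {scalar L}) : Prop := {
  str_even : forall x, hdeg true x -> tau x = 0;
  str_bracket : forall x y, tau (br x y) = 0
}.

Record lie_rinehart_superalgebra (A L : superSpaceType K) (mul : A -> A -> A)
    (act : A -> L -> L) (br : L -> L -> L) (mu : L -> A -> A) : Prop := {
  lr_algebra : supercomm_superalgebra mul;
  lr_lie : lie_superalgebra br;
  lr_module : supermodule mul act;
  lr_rep : lie_representation br mu;
  lr_der : forall i x, hdeg i x -> superderivation mul i (mu x);
  lr_anchor : forall i j a x, hdeg i a -> hdeg j x -> forall b,
    mu (act a x) b = mul a (mu x b);
  lr_leibniz : forall i j k x a y, hdeg i x -> hdeg j a -> hdeg k y ->
    br x (act a y) = act (mu x a) y + (-1) ^+ (j && i) *: act a (br x y)
}.

Record three_lie_superalgebra (L : superSpaceType K)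
    (br : L -> L -> L -> L) : Prop := {
  tl_even : even_trilinear br;
  tl_skew12 : forall i j k x y z, hdeg i x -> hdeg j y -> hdeg k z ->
    br x y z = - ((-1) ^+ (i && j) *: br y x z);
  tl_skew23 : forall i j k x y z, hdeg i x -> hdeg j y -> hdeg k z ->
    br x y z = - ((-1) ^+ (j && k) *: br x z y);
  tl_fundamental : forall i j k l m x y z u v,
    hdeg i x -> hdeg j y -> hdeg k z -> hdeg l u -> hdeg m v ->
    br x y (br z u v) =
      br (br x y z) u v
      + (-1) ^+ (k && (i (+) j)) *: br z (br x y u) v
      + (-1) ^+ ((k (+) l) && (i (+) j)) *: br z u (br x y v)
}.

(* An even linear map L /\ L -> gl(V) is given as an even trilinear map       *)
(* L -> L -> V -> V that is super-skew-symmetric in its first two arguments.  *)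
Record three_lie_representation (L V : superSpaceType K)
    (br : L -> L -> L -> L) (rho : L -> L -> V -> V) : Prop := {
  tlrep_even : even_trilinear rho;
  tlrep_skew : forall i j x y, hdeg i x -> hdeg j y -> forall v,
    rho x y v = - ((-1) ^+ (i && j) *: rho y x v);
  tlrep_comm : forall i1 i2 i3 i4 x1 x2 x3 x4,
    hdeg i1 x1 -> hdeg i2 x2 -> hdeg i3 x3 -> hdeg i4 x4 -> forall v,
    rho x1 x2 (rho x3 x4 v)
      - (-1) ^+ ((i1 (+) i2) && (i3 (+) i4)) *: rho x3 x4 (rho x1 x2 v)
    = rho (br x1 x2 x3) x4 v
      - (-1) ^+ (i3 && i4) *: rho (br x1 x2 x4) x3 v;
  tlrep_bracket : forall i1 i2 i3 i4 x1 x2 x3 x4,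
    hdeg i1 x1 -> hdeg i2 x2 -> hdeg i3 x3 -> hdeg i4 x4 -> forall v,
    rho (br x1 x2 x3) x4 v
    = rho x1 x2 (rho x3 x4 v)
      + (-1) ^+ (i1 && (i2 (+) i3)) *: rho x2 x3 (rho x1 x4 v)
      + (-1) ^+ (i3 && (i1 (+) i2)) *: rho x3 x1 (rho x2 x4 v)
}.

Record three_lie_rinehart_superalgebra (A L : superSpaceType K)
    (mul : A -> A -> A) (act : A -> L -> L) (br : L -> L -> L -> L)
    (rho : L -> L -> A -> A) : Prop := {
  tlr_algebra : supercomm_superalgebra mul;
  tlr_module : supermodule mul act;
  tlr_lie : three_lie_superalgebra br;
  tlr_rep : three_lie_representation br rho;
  tlr_der : forall i j x y, hdeg i x -> hdeg j y ->
    superderivation mul (i (+) j) (rho x y);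
  tlr_anchor_r : forall i j k a x y, hdeg i a -> hdeg j x -> hdeg k y ->
    forall b, rho (act a x) y b = (-1) ^+ (i && j) *: rho x (act a y) b;
  tlr_anchor_l : forall i j k a x y, hdeg i a -> hdeg j x -> hdeg k y ->
    forall b, rho (act a x) y b = mul a (rho x y b);
  tlr_leibniz : forall i j k l x y a z,
    hdeg i x -> hdeg j y -> hdeg k a -> hdeg l z ->
    br x y (act a z) =
      (-1) ^+ (k && (i (+) j)) *: act a (br x y z) + act (rho x y a) z
}.

(* The formulas for [x1,x2,x3]_tau and rho_tau(x,y) are given on homogeneous  *)
(* elements; they are extended multilinearly by summing over the homogeneous  *)
(* components of the arguments.                                               *)
Definition tau_bracket (L : superSpaceType K) (br : L -> L -> L)
    (tau : {scalar L}) (x1 x2 x3 : L) : L :=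
  \sum_(i1 : bool) \sum_(i2 : bool) \sum_(i3 : bool)
    (tau (hcomp i1 x1) *: br (hcomp i2 x2) (hcomp i3 x3)
     - (-1) ^+ (i1 && i2) *: (tau (hcomp i2 x2) *: br (hcomp i1 x1) (hcomp i3 x3))
     + (-1) ^+ (i3 && (i1 (+) i2))
         *: (tau (hcomp i3 x3) *: br (hcomp i1 x1) (hcomp i2 x2))).

Definition tau_rho (A L : superSpaceType K) (mu : L -> A -> A)
    (tau : {scalar L}) (x y : L) (a : A) : A :=
  \sum_(i : bool) \sum_(j : bool)
    (tau (hcomp i x) *: mu (hcomp j y) a
     - (-1) ^+ (i && j) *: (tau (hcomp j y) *: mu (hcomp i x) a)).

Lemma hdeg_hcomp (V : superSpaceType K) i j (v : V) :
  hdeg i v -> hcomp j v = if j == i then v else 0.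
Proof. by move=> <-; rewrite hcomp_proj. Qed.

Lemma tau_bracketE (L : superSpaceType K) (br : L -> L -> L) (tau : {scalar L})
    i1 i2 i3 x1 x2 x3 :
  even_bilinear br -> hdeg i1 x1 -> hdeg i2 x2 -> hdeg i3 x3 ->
  tau_bracket br tau x1 x2 x3 =
    tau x1 *: br x2 x3 - (-1) ^+ (i1 && i2) *: (tau x2 *: br x1 x3)
    + (-1) ^+ (i3 && (i1 (+) i2)) *: (tau x3 *: br x1 x2).
Proof.
move=> [[br_l br_r] _] h1 h2 h3.
have b0x x : br 0 x = 0.
  by have := br_l x (-1) 0 0; rewrite /= scaler0 addr0 scaleN1r addNr.
have bx0 x : br x 0 = 0.
  by have := br_r x (-1) 0 0; rewrite /= scaler0 addr0 scaleN1r addNr.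
rewrite /tau_bracket !big_bool !(hdeg_hcomp _ h1) !(hdeg_hcomp _ h2).
rewrite !(hdeg_hcomp _ h3); case: i1 i2 i3 {h1 h2 h3} => [] [] [] /=.
all: by rewrite !(linear0, b0x, bx0, scale0r, scaler0, subr0, addr0, add0r).
Qed.

Lemma tau_rhoE (A L : superSpaceType K) (mu : L -> A -> A) (tau : {scalar L})
    i j x y a :
  even_bilinear mu -> hdeg i x -> hdeg j y ->
  tau_rho mu tau x y a = tau x *: mu y a - (-1) ^+ (i && j) *: (tau y *: mu x a).
Proof.
move=> [[mu_l _] _] hx hy.
have mu0 b : mu 0 b = 0.
  by have := mu_l b (-1) 0 0; rewrite /= scaler0 addr0 scaleN1r addNr.
rewrite /tau_rho !big_bool !(hdeg_hcomp _ hx) !(hdeg_hcomp _ hy).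
case: i j {hx hy} => [] [] /=.
all: by rewrite !(linear0, mu0, scale0r, scaler0, subr0, addr0, add0r).
Qed.

End Structures.

(* Main.v *)
Require Import Defs.
From HB Require Import structures.
From mathcomp Require Import all_boot all_order all_algebra.
From mathcomp Require Import ring.
Import GRing.Theory.
Local Open Scope ring_scope.

(** An even form [tau] vanishes on odd elements, so every Koszul sign attached
to a factor [tau x] is trivial and the formulas become sign-free:
[x,y,z]_tau = tau(x)[y,z] - tau(y)[x,z] + tau(z)[x,y] and
rho_tau(x,y) = tau(x)mu(y) - tau(y)mu(x).  Put D = tau(x)y - tau(y)x, which is
homogeneous of degree |x|+|y| (D is [tau_wedge x y] below).
Then rho_tau(x,y) = mu(D) and
[x,y,w]_tau = [D,w] + tau(w)[x,y], and [tau] vanishes on ternary brackets, so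
the ternary identities reduce to the binary ones for D. *)

(** * Calculus of even bilinear maps *)

Section EvenBilinear.
Context {K : fieldType} {U V W : superSpaceType K} {f : U -> V -> W}.
Hypothesis hf : even_bilinear f.

Lemma bilinPl c u u' v : f (c *: u + u') v = c *: f u v + f u' v.
Proof. by case: hf => [[fl _] _]; apply: fl. Qed.

Lemma bilinPr c u v v' : f u (c *: v + v') = c *: f u v + f u v'.
Proof. by case: hf => [[_ fr] _]; apply: fr. Qed.

Lemma bilinDl u u' v : f (u + u') v = f u v + f u' v.
Proof. by have := bilinPl 1 u u' v; rewrite !scale1r. Qed.

Lemma bilinDr u v v' : f u (v + v') = f u v + f u v'.
Proof. by have := bilinPr 1 u v v'; rewrite !scale1r. Qed.

Lemma bilin0l v : f 0 v = 0.
Proof. by apply: (addrI (f 0 v)); rewrite -bilinDl !addr0. Qed.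

Lemma bilin0r u : f u 0 = 0.
Proof. by apply: (addrI (f u 0)); rewrite -bilinDr !addr0. Qed.

Lemma bilinZl c u v : f (c *: u) v = c *: f u v.
Proof. by rewrite -[c *: u]addr0 bilinPl bilin0l addr0. Qed.

Lemma bilinZr c u v : f u (c *: v) = c *: f u v.
Proof. by rewrite -[c *: v]addr0 bilinPr bilin0r addr0. Qed.

Lemma bilinNl u v : f (- u) v = - f u v.
Proof. by rewrite -scaleN1r bilinZl scaleN1r. Qed.

Lemma bilinNr u v : f u (- v) = - f u v.
Proof. by rewrite -scaleN1r bilinZr scaleN1r. Qed.

Lemma bilin_suml (F : bool -> U) v : f (\sum_i F i) v = \sum_i f (F i) v.
Proof. by rewrite !big_bool /= bilinDl. Qed.

Lemma bilin_sum (F : bool -> U) (G : bool -> V) :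
  f (\sum_i F i) (\sum_j G j) = \sum_i \sum_j f (F i) (G j).
Proof.
rewrite bilin_suml; apply: eq_bigr => i _.
by rewrite !big_bool /= bilinDr.
Qed.

Lemma bilin_hdeg {i j u v} : hdeg i u -> hdeg j v -> hdeg (i (+) j) (f u v).
Proof. by case: hf => _; apply. Qed.

Definition bilinE := (bilinDl, bilinDr, bilinNl, bilinNr, bilinZl, bilinZr).

End EvenBilinear.

(** * Homogeneous elements and components *)

Section Homogeneous.
Context {K : fieldType} {V : superSpaceType K}.
Implicit Types (i : bool) (u v : V).

Lemma hdeg0 i : hdeg i (0 : V).
Proof.
rewrite /hdeg; have := hcomp_linear i (-1) (0 : V) 0.
by rewrite scaler0 addr0 scaleN1r addNr.
Qed.

Lemma hdegZ i c v : hdeg i v -> hdeg i (c *: v).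
Proof.
by move=> hv; rewrite /hdeg -[c *: v]addr0 hcomp_linear hv (hdeg0 i).
Qed.

Lemma hdegD i u v : hdeg i u -> hdeg i v -> hdeg i (u + v).
Proof.
by move=> hu hv; rewrite /hdeg -[u]scale1r hcomp_linear hu hv scale1r.
Qed.

Lemma hdegN i v : hdeg i v -> hdeg i (- v).
Proof. by rewrite -scaleN1r; apply: hdegZ. Qed.

Lemma hcomp_hdeg i v : hdeg i (hcomp i v).
Proof. by rewrite /hdeg hcomp_proj eqxx. Qed.

Lemma sum_hcomp v : \sum_i hcomp i v = v.
Proof. by rewrite big_bool /= addrC hcomp_sum. Qed.

End Homogeneous.

(** After scaling by [(-1)^{ik}], the difference of the two sides is the cyclic Jacobi sum, once
    skew-symmetry has turned around [[z,x]] and [[z,[x,y]]]. This derivation form is what the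
    fundamental identity uses. *)
Lemma lie_jacobi_derivation {K : fieldType} {L : superSpaceType K}
    {br : L -> L -> L} {i j k x y z} :
  lie_superalgebra br -> hdeg i x -> hdeg j y -> hdeg k z ->
  br x (br y z) = br (br x y) z + (-1) ^+ (i && j) *: br y (br x z).
Proof.
move=> hL hx hy hz; have eb := lie_even hL.
have jac := lie_jacobi hL hx hy hz.
apply: (@scalerI _ _ ((-1) ^+ (i && k))); first by rewrite signr_eq0.
apply/eqP; rewrite -subr_eq0 -{}jac (lie_skew hL hz hx).
rewrite (lie_skew hL hz (bilin_hdeg eb hx hy)) !(bilinE eb).
rewrite scalerDr opprD addrA addrAC; apply/eqP; congr (_ + _ + _).
  by case: i j k {hx hy hz} => [] [] []; rewrite /= ?scaleN1r ?scale1r ?opprK.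
by case: i j k {hx hy hz} => [] [] []; rewrite /= ?scaleN1r ?scale1r ?opprK.
Qed.

(** * The ternary bracket induced by a supertrace *)

Section TauStructure.
Context {K : fieldType} {L : superSpaceType K} {br : L -> L -> L}.
Context {tau : {scalar L}}.
Hypotheses (hbr : even_bilinear br) (htau : supertrace br tau).

(** The exponent [b] is arbitrary, so sums of degrees such as [i (+) j] are absorbed too. *)
Lemma tau_sign_absorb {i x} b :
  hdeg i x -> (-1) ^+ (i && b) * tau x = tau x.
Proof.
by case: i => [/(str_even htau) -> | _]; rewrite ?mulr0 // expr0 mul1r.
Qed.

Lemma sum_tau_hcomp x : \sum_i tau (hcomp i x) = tau x.
Proof. by rewrite -linear_sum sum_hcomp. Qed.

Lemma sum_tau_bracket_hcomp x y z :
  \sum_i \sum_j \sum_k tau (hcomp i x) *: br (hcomp j y) (hcomp k z)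
  = tau x *: br y z.
Proof.
rewrite -(sum_tau_hcomp x) -{2}(sum_hcomp y) -{2}(sum_hcomp z) (bilin_sum hbr).
rewrite scaler_suml; apply: eq_bigr => i _.
rewrite scaler_sumr; apply: eq_bigr => j _.
by rewrite scaler_sumr.
Qed.

Lemma tau_bracket_signfree x y z :
  tau_bracket br tau x y z
  = tau x *: br y z - tau y *: br x z + tau z *: br x y.
Proof.
rewrite /tau_bracket.
transitivity (\sum_i1 \sum_i2 \sum_i3
  (tau (hcomp i1 x) *: br (hcomp i2 y) (hcomp i3 z)
   - tau (hcomp i2 y) *: br (hcomp i1 x) (hcomp i3 z)
   + tau (hcomp i3 z) *: br (hcomp i1 x) (hcomp i2 y))).
  apply: eq_bigr => i _; apply: eq_bigr => j _; apply: eq_bigr => k _.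
  rewrite !scalerA [i && j]andbC.
  by rewrite !(tau_sign_absorb _ (hcomp_hdeg _ _)).
(* The three summands carry [tau] on different indices; reordering each triple sum puts that index
   outermost, as [sum_tau_bracket_hcomp] requires. *)
have split3 (F G H : bool -> bool -> bool -> L) :
    \sum_i \sum_j \sum_k (F i j k - G j i k + H k i j)
    = \sum_i \sum_j \sum_k F i j k - \sum_j \sum_i \sum_k G j i k
      + \sum_k \sum_i \sum_j H k i j.
  rewrite [X in _ - X]exchange_big [X in _ + X]exchange_big -sumrB -big_split.
  apply: eq_bigr => i _ /=; rewrite [X in _ + X]exchange_big -sumrB -big_split.
  by apply: eq_bigr => j _ /=; rewrite -sumrB -big_split.
by rewrite split3 !sum_tau_bracket_hcomp.
Qed.

Lemma tau_hdeg {i j x} {V : superSpaceType K} {v : V} :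
  hdeg i x -> hdeg j v -> hdeg (i (+) j) (tau x *: v).
Proof.
case: i => [/(str_even htau) -> _ | _]; last exact: hdegZ.
by rewrite scale0r; apply: hdeg0.
Qed.

(** The contraction of [x /\ y] by [tau]. *)
Definition tau_wedge x y : L := tau x *: y - tau y *: x.

Lemma tau_wedge_even : even_bilinear tau_wedge.
Proof.
split; last first.
  move=> i j x y hx hy; apply: hdegD; first exact: tau_hdeg.
  by apply: hdegN; rewrite addbC; apply: tau_hdeg.
split=> [y | x] c u v; rewrite /= /tau_wedge (linearP tau) /= scalerBr.
  by rewrite scalerDl scalerDr !scalerA [tau y * c]mulrC opprD addrACA.
by rewrite scalerDl scalerDr !scalerA [tau x * c]mulrC opprD addrACA.
Qed.

Lemma tau_wedge_skew x y : tau_wedge y x = - tau_wedge x y.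
Proof. by rewrite opprB. Qed.

(** The sign is nontrivial only for two odd arguments, where both coefficients vanish. Hence plain
    skew-symmetry of the contraction is also super-skew-symmetry. *)
Lemma tau_wedge_sign {i j x y} : hdeg i x -> hdeg j y ->
  (-1) ^+ (i && j) *: tau_wedge x y = tau_wedge x y.
Proof.
move=> hx hy; rewrite scalerBr !scalerA (tau_sign_absorb _ hx) andbC.
by rewrite (tau_sign_absorb _ hy).
Qed.

Lemma tau_bracket_wedge x y z :
  tau_bracket br tau x y z = br (tau_wedge x y) z + tau z *: br x y.
Proof. by rewrite tau_bracket_signfree !(bilinE hbr). Qed.

Lemma tau_tau_bracket x y z : tau (tau_bracket br tau x y z) = 0.
Proof.
by rewrite tau_bracket_wedge linearD linearZ /= !(str_bracket htau) mulr0 addr0.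
Qed.

Lemma tau_wedge_bracketl x y z w :
  tau_wedge (tau_bracket br tau x y z) w
  = - (tau w *: tau_bracket br tau x y z).
Proof. by rewrite /tau_wedge tau_tau_bracket scale0r sub0r. Qed.

Lemma tau_bracket_even : even_trilinear (tau_bracket br tau).
Proof.
split=> [t u c v w | t v c u w | u v c t w | i j k t u v ht hu hv].
- rewrite !tau_bracket_wedge (bilinPr hbr) (linearP tau) scalerDl scalerDr.
  by rewrite scalerA addrACA.
- rewrite !tau_bracket_wedge (bilinPr tau_wedge_even) (bilinPr hbr).
  by rewrite (bilinPl hbr) !scalerDr !scalerA [c * _]mulrC addrACA.
- rewrite !tau_bracket_wedge (bilinPl tau_wedge_even) (bilinPl hbr _ _ _ v).
  by rewrite (bilinPl hbr _ _ _ u) !scalerDr !scalerA [c * _]mulrC addrACA.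
- rewrite tau_bracket_wedge; apply: hdegD.
    exact: (bilin_hdeg hbr (bilin_hdeg tau_wedge_even ht hu) hv).
  by rewrite addbC; apply: (tau_hdeg hv (bilin_hdeg hbr ht hu)).
Qed.

Lemma tau_bracket_three_lie :
  lie_superalgebra br -> three_lie_superalgebra (tau_bracket br tau).
Proof.
move=> hL; split; first exact: tau_bracket_even.
- move=> i j k x y z hx hy hz; rewrite !tau_bracket_wedge (tau_wedge_skew x y).
  rewrite (bilinNl hbr) scalerDr scalerN opprD opprK.
  rewrite -(bilinZl hbr _ (tau_wedge x y)).
  rewrite (tau_wedge_sign hx hy) (lie_skew hL hx hy).
  by rewrite scalerN !scalerA mulrC.
- move=> i j k x y z hx hy hz; rewrite !tau_bracket_signfree.
  rewrite (lie_skew hL hy hz) !scalerDr !scalerN !scalerA.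
  rewrite (tau_sign_absorb _ hy) [j && k]andbC (tau_sign_absorb _ hz).
  by rewrite mulrC !opprD !opprK addrAC.
move=> i j k l m x y z u v hx hy hz hu hv.
set d := i (+) j.
(* Hiding the formulas of [W] and [E] keeps the bilinear expansion below from splitting [W]. *)
have [W [E [hW hE adE]]] : exists W E, [/\ hdeg d W, hdeg d E &
    forall w, tau_bracket br tau x y w = br W w + tau w *: E].
  exists (tau_wedge x y), (br x y); split.
  - exact: (bilin_hdeg tau_wedge_even hx hy).
  - exact: (bilin_hdeg hbr hx hy).
  - exact: tau_bracket_wedge.
have tau_ad w : tau (br W w + tau w *: E) = 0 by rewrite -adE tau_tau_bracket.
have adW := lie_jacobi_derivation hL hW.
rewrite !adE tau_tau_bracket scale0r addr0 !tau_bracket_signfree !tau_ad.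
rewrite !scale0r !(bilinE hbr) (adW _ _ _ _ hu hv) (adW _ _ _ _ hz hv).
rewrite (adW _ _ _ _ hz hu).
have signz : (-1) ^+ (d && k) * tau z = tau z.
  by rewrite andbC (tau_sign_absorb _ hz).
have signu : (-1) ^+ (d && l) * tau u = tau u.
  by rewrite andbC (tau_sign_absorb _ hu).
have skewE : br u E = - ((-1) ^+ (d && l) *: br E u).
  by rewrite (lie_skew hL hu hE) andbC.
have -> : (-1) ^+ ((k (+) l) && d) = (-1) ^+ (d && k) * (-1) ^+ (d && l) :> K.
  by rewrite andbC andb_addr signr_addb.
rewrite {}skewE [k && d]andbC add0r subr0 addr0.
have qq : (-1) ^+ (d && l) * (-1) ^+ (d && l) = 1 :> K.
  by rewrite -expr2 sqrr_sign.
(* The signs become scalars: [q * q = 1], while [tau z] absorbs [p] and [tau u] absorbs [q]. The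
   coefficients then match by commutative algebra. *)
move: (_ ^+ (d && k)) (_ ^+ (d && l)) qq signz signu => p q qq signz signu.
rewrite !(scalerDr, scalerN, opprD) !scalerA.
have -> : p * (tau z * tau u) = tau u * tau z by rewrite mulrA signz mulrC.
have -> : p * tau z = tau z by [].
have -> : p * (tau v * tau u) = tau v * tau u * p by ring.
have -> : p * q * tau z * tau v * q = tau v * tau z by ring: qq signz.
have -> : p * q * tau z = tau z * q by ring: signz.
have -> : p * q * tau u = tau u * p by ring: signu.
have -> : p * q * (tau u * tau v) = tau v * tau u * p by ring: signu.
rewrite [p * tau v]mulrC.
(* The six terms free of [E] form the left-hand side; the other six cancel in pairs, in [[E,v]],
   [[E,u]] and [[z,E]]. *)
rewrite [RHS](AC (((2*2)*(2*2))*(2*2))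
                 (((5*9)*(1*11)*(3*7))*((2*6)*(4*10)*(8*12)))).
by rewrite /= addNr !subrr !addr0.
Qed.

(** * The induced representation *)

Lemma sum_tau_mu_hcomp {A : superSpaceType K} {mu : L -> A -> A} x y a :
  even_bilinear mu ->
  \sum_i \sum_j tau (hcomp i x) *: mu (hcomp j y) a = tau x *: mu y a.
Proof.
move=> hmu; rewrite -(sum_tau_hcomp x) -{2}(sum_hcomp y) (bilin_suml hmu).
by rewrite scaler_suml; apply: eq_bigr => i _; rewrite scaler_sumr.
Qed.

Lemma tau_rho_wedge {A : superSpaceType K} {mu : L -> A -> A} x y a :
  even_bilinear mu -> tau_rho mu tau x y a = mu (tau_wedge x y) a.
Proof.
move=> hmu; rewrite /tau_rho.
transitivity (\sum_i \sum_j (tau (hcomp i x) *: mu (hcomp j y) a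
   - tau (hcomp j y) *: mu (hcomp i x) a)).
  apply: eq_bigr => i _; apply: eq_bigr => j _; rewrite scalerA andbC.
  by rewrite (tau_sign_absorb _ (hcomp_hdeg _ _)).
rewrite !(bilinE hmu) -(sum_tau_mu_hcomp x y a hmu).
rewrite -(sum_tau_mu_hcomp y x a hmu).
rewrite [X in _ - X]exchange_big -sumrB.
by apply: eq_bigr => i _; rewrite -sumrB.
Qed.

(** In the commutator identity the left side is [mu] of the bracket of two contractions; on the
    right the two multiples of [[x1,x2]] by [tau x3 * tau x4] cancel. The other identity rests on
    the vanishing of the double contraction of [x1 /\ x2 /\ x3] by [tau]. *)
Lemma tau_rho_three_lie_representation {V : superSpaceType K}
    {mu : L -> V -> V} :
  lie_superalgebra br -> lie_representation br mu ->
  three_lie_representation (tau_bracket br tau) (tau_rho mu tau).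
Proof.
move=> hL hmu; have emu := lrep_even hmu.
have rhoE x y v : tau_rho mu tau x y v = mu (tau_wedge x y) v.
  exact: tau_rho_wedge.
split.
- split=> [t u c v w | t v c u w | u v c t w | i j k t u v ht hu hv].
  + by rewrite !rhoE (bilinPr emu).
  + by rewrite !rhoE (bilinPr tau_wedge_even) (bilinPl emu).
  + by rewrite !rhoE (bilinPl tau_wedge_even) (bilinPl emu).
  + rewrite rhoE.
    exact: (bilin_hdeg emu (bilin_hdeg tau_wedge_even ht hu) hv).
- move=> i j x y hx hy v; rewrite !rhoE -(bilinZl emu) -(bilinNl emu).
  rewrite (tau_wedge_skew x y) scalerN (tau_wedge_sign hx hy).
  by rewrite opprK.
- move=> i1 i2 i3 i4 x1 x2 x3 x4 h1 h2 h3 h4 v.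
  have hW12 := bilin_hdeg tau_wedge_even h1 h2.
  have hW34 := bilin_hdeg tau_wedge_even h3 h4.
  rewrite !rhoE -(lrep_bracket hmu hW12 hW34).
  rewrite !tau_wedge_bracketl !tau_bracket_wedge [tau_wedge x3 x4]/tau_wedge.
  move: (tau_wedge x1 x2) => W; rewrite -(bilinZl emu) -(bilinNl emu).
  rewrite -(bilinDl emu); congr (mu _ v).
  rewrite !(bilinE hbr) scalerN opprK scalerA (tau_sign_absorb _ h3).
  rewrite !scalerDr !scalerA opprD [tau x4 * _]mulrC addrACA addNr addr0.
  by rewrite addrC.
move=> i1 i2 i3 i4 x1 x2 x3 x4 h1 h2 h3 h4 v.
rewrite !rhoE tau_wedge_bracketl.
have expand W x : mu W (mu (tau_wedge x x4) v)
    = tau x *: mu W (mu x4 v) - tau x4 *: mu W (mu x v).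
  by rewrite /tau_wedge !(bilinE emu).
rewrite !{}expand.
(* The terms ending in [mu x4] cancel, leaving a multiple of [tau x4]. *)
have cyc : tau x3 *: tau_wedge x1 x2 + tau x1 *: tau_wedge x2 x3
    + tau x2 *: tau_wedge x3 x1 = 0.
  rewrite /tau_wedge !scalerBr !scalerA.
  rewrite [tau x3 * tau x1]mulrC [tau x3 * tau x2]mulrC [tau x2 * tau x1]mulrC.
  rewrite [LHS](AC ((2*2)*2) ((1*4)*(2*5)*(3*6))) /=.
  by rewrite addNr !subrr !addr0.
(* The factor [tau x2] removes [i2] from the exponent; the remaining sign is absorbed by the
   contraction of [x3] and [x1]. *)
have sign2 w : (-1) ^+ (i3 && (i1 (+) i2)) *: (tau x2 *: mu (tau_wedge x3 x1) w)
    = tau x2 *: mu (tau_wedge x3 x1) w.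
  case: i2 h2 => [/(str_even htau) -> | _]; first by rewrite !scale0r scaler0.
  rewrite addbF scalerA mulrC -scalerA -[(-1) ^+ _ *: _](bilinZl emu).
  by rewrite tau_wedge_sign.
rewrite 2!scalerBr sign2 [_ *: (tau x1 *: _)]scalerA (tau_sign_absorb _ h1).
rewrite [RHS](AC ((2*2)*2) ((1*3*5)*(2*4*6))) /=.
rewrite -!(bilinZl emu _ _ (mu x4 v)) -!(bilinDl emu) cyc (bilin0l emu) add0r.
rewrite ![_ *: (tau x4 *: _)]scalerA ![_ * tau x4]mulrC -!scalerA -!opprD.
rewrite -!scalerDr (bilinNl emu) (bilinZl emu); congr (- (_ *: _)).
have sign_drop b i c x : hdeg i x ->
    (-1) ^+ (b && (i (+) c)) * tau x = (-1) ^+ (b && c) * tau x.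
  by case: i => [/(str_even htau) -> | //]; rewrite !mulr0.
(* Both sides expand into the six compositions of two of [mu x1], [mu x2], [mu x3], each weighted by
   [tau] of the third vector. *)
rewrite tau_bracket_signfree !(bilinE emu).
rewrite (lrep_bracket hmu h2 h3) (lrep_bracket hmu h1 h3).
rewrite (lrep_bracket hmu h1 h2) !scalerBr !scalerA.
rewrite (sign_drop i1 _ _ _ h2) (tau_sign_absorb _ h3) (sign_drop i3 _ _ _ h1).
rewrite [i2 (+) i3]addbC (sign_drop i1 _ _ _ h3) [i3 && i2]andbC.
rewrite ![_ * tau _]mulrC opprB.
by rewrite [LHS](AC ((2*2)*2) ((1*4)*(3*6)*(5*2))).
Qed.

End TauStructure.

(** * Compatibility with the [A]-module structure *)

Arguments tau_wedge {K L} tau x y.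

Theorem theorem2p1 (K : fieldType) (A L : superSpaceType K)
    (mul : A -> A -> A) (act : A -> L -> L) (br : L -> L -> L)
    (mu : L -> A -> A) (tau : {scalar L})
    (hL : lie_rinehart_superalgebra mul act br mu)
    (htau : supertrace br tau)
    (hcompat : forall (i j k : bool) (x y : L) (a : A),
      hdeg i x -> hdeg j y -> hdeg k a ->
      tau (act a x) *: y = tau x *: act a y) :
  three_lie_rinehart_superalgebra mul act (tau_bracket br tau) (tau_rho mu tau).
Proof.
have hbr := lie_even (lr_lie hL); have hmu := lrep_even (lr_rep hL).
have hact := sm_even (lr_module hL).
have hwedge := tau_wedge_even htau.
have rhoE x y a : tau_rho mu tau x y a = mu (tau_wedge tau x y) a.
  exact: (tau_rho_wedge htau _ _ _ hmu).
(* If x is even then ax is odd, so tau(x) ay = tau(ax) y = 0. *)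
have act_odd j k a x y : hdeg true a -> hdeg j x -> hdeg k y ->
    tau x *: act a y = 0.
  move=> ha hx hy; case: j hx => [/(str_even htau) -> | hx].
    by rewrite scale0r.
  rewrite -(hcompat _ _ _ _ _ _ hx hy ha).
  by rewrite (str_even htau (bilin_hdeg hact ha hx)) scale0r.
(* Compatibility turns [tau(ax) y] into [tau(x) ay], so [a] factors out of both terms. *)
have act_wedgel i j k a x y : hdeg i a -> hdeg j x -> hdeg k y ->
    tau_wedge tau (act a x) y = act a (tau_wedge tau x y).
  move=> ha hx hy; rewrite /tau_wedge (hcompat _ _ _ _ _ _ hx hy ha).
  by rewrite (bilinDr hact) (bilinNr hact) !(bilinZr hact).
have act_wedger i j k a x y : hdeg i a -> hdeg j x -> hdeg k y ->
    tau_wedge tau x (act a y) = act a (tau_wedge tau x y).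
  move=> ha hx hy; rewrite (tau_wedge_skew (act a y)).
  rewrite (act_wedgel _ _ _ _ _ _ ha hy hx) (tau_wedge_skew x).
  by rewrite (bilinNr hact) opprK.
split.
- exact: lr_algebra hL.
- exact: lr_module hL.
- exact: (tau_bracket_three_lie hbr htau (lr_lie hL)).
- exact: (tau_rho_three_lie_representation hbr htau (lr_lie hL) (lr_rep hL)).
- move=> i j x y hx hy.
  have [Dlin Ddeg Dleib] := lr_der hL (bilin_hdeg hwedge hx hy).
  split=> [c a b | k a ha | k l a b ha hb]; rewrite !rhoE.
  + exact: Dlin.
  + exact: Ddeg.
  + exact: (Dleib _ _ _ _ ha hb).
- move=> i j k a x y ha hx hy b.
  rewrite !rhoE (act_wedgel _ _ _ _ _ _ ha hx hy).
  rewrite (act_wedger _ _ _ _ _ _ ha hx hy).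
  (* Both contractions equal [a] times that of [x] and [y], without the required Koszul sign. For
     odd [a] this common value is zero, so the sign is harmless. *)
  case: i ha => [ha | _]; last by rewrite scale1r.
  rewrite /tau_wedge (bilinDr hact) (bilinNr hact) !(bilinZr hact).
  rewrite (act_odd _ _ _ _ _ ha hx hy) (act_odd _ _ _ _ _ ha hy hx).
  by rewrite subr0 (bilin0l hmu) scaler0.
- move=> i j k a x y ha hx hy b.
  rewrite !rhoE (act_wedgel _ _ _ _ _ _ ha hx hy).
  exact: (lr_anchor hL ha (bilin_hdeg hwedge hx hy)).
- move=> i j k l x y a z hx hy ha hz.
  rewrite !(tau_bracket_wedge hbr htau) rhoE.
  rewrite (lr_leibniz hL (bilin_hdeg hwedge hx hy) ha hz).
  have hE := bilin_hdeg hbr hx hy.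
  (* Compatibility with [[x,y]] as second vector turns [tau(az) [x,y]] into [tau(z) a[x,y]]. The
     right side has this term with a Koszul sign, which matters only for odd [a], where the term
     vanishes. *)
  rewrite (hcompat _ _ _ _ _ _ hz hE ha) (bilinDr hact) (bilinZr hact) scalerDr.
  rewrite addrAC addrC -!addrA; congr (_ + _).
  rewrite addrC; congr (_ + _).
  case: k ha => [ha | _]; last by rewrite scale1r.
  by rewrite (act_odd _ _ _ _ _ ha hz hE) scaler0.
Qed.
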